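(* Let $(g,h):(\mathbb R^n,0)\to\mathbb R^q\times\mathbb R^r$ be a constraint map-germ with non-empty feasible set-germ, and let $(g,h)_{\iota_{(i)},(k)}$ be a reduction of $(g,h)$. Then for each $X\in\{\mathrm{LICQ},\mathrm{MFCQ},\mathrm{ACQ},\mathrm{GCQ}\}$, $(g,h)$ satisfies $X$ at the origin if and only if $(g,h)_{\iota_{(i)},(k)}$ satisfies $X$ at the origin.
   Context: A constraint map-germ is a smooth map-germ $(g,h):(\mathbb R^n,0)\to\mathbb R^q\times\mathbb R^r$ with $h(0)=0$; its feasible set-germ $M(g,h)$ is the germ at $0$ of $\{x: g_i(x)\le0\ \forall i,\ h_j(x)=0\ \forall j\}$. It is non-empty iff $g_j(0)\le0$ for all $j$. Let $I=\{j: g_j(0)=0\}$ and $g_I=(g_j)_{j\in I}$. - LICQ: the Jacobian of $(g_I,h)$ at $0$ has full rank $|I|+r$. - MFCQ: $dh_0$ has rank $r$ and there is $d\in\mathbb R^n$ with $dg_{j,0}(d)<0$ for all $j\in I$ and $dh_0(d)=0$. - Tangent cone: $C^+(g,h)=\{d\in\mathbb R^n:\exists x_m\in M(g,h),\ x_m\to0,\ \exists t_m>0,\ t_mx_m\to d\}$. Linearized cone: $L^+(g,h)=\{d\in\mathbb R^n: dg_{j,0}(d)\le0\ \forall j\in I,\ dh_0(d)=0\}$. - ACQ: $C^+(g,h)=L^+(g,h)$. - GCQ: $C^+(g,h)^\circ=L^+(g,h)^\circ$, where $X^\circ=\{v: v\cdot d\le0\ \forall d\in X\}$. Reduction: let $(k)=(k_1,\dots,k_{q-s})$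 be a set of indices in $\{1,\dots,q\}$ with $g_{k_a}(0)<0$ for all $a$, and $(i)=(i_1,\dots,i_{r-\ell})$ a set of indices in $\{1,\dots,r\}$ such that $d(h_{i_1})_0,\dots,d(h_{i_{r-\ell}})_0$ are linearly independent. Let $\iota_{(i)}:(\mathbb R^{n-r+\ell},0)\to(\mathbb R^n,0)$ be an immersion-germ onto the submanifold-germ $(h_{i_1},\dots,h_{i_{r-\ell}})^{-1}(0)$. The reduction $(g,h)_{\iota_{(i)},(k)}:(\mathbb R^{n-r+\ell},0)\to\mathbb R^{s}\times\mathbb R^{\ell}$ is the constraint map-germ whose inequality components are $g_j\circ\iota_{(i)}$ for $j\notin(k)$ and whose equality components are $h_j\circ\iota_{(i)}$ for $j\notin(i)$. *)

(* Defs.v *)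
From HB Require Import structures.
From mathcomp Require Import all_boot all_order all_algebra.
From mathcomp Require Import all_classical all_reals all_analysis.

Set Implicit Arguments.
Unset Strict Implicit.
Unset Printing Implicit Defensive.

Import Order.TTheory GRing.Theory Num.Theory numFieldNormedType.Exports.

Local Open Scope classical_set_scope.
Local Open Scope ring_scope.

(* Points of R^n are row vectors.  A map-germ at 0 is given by a total function
   representing it: only its values near 0 matter in the definitions below.
   Likewise a set-germ at 0 is given by a representative set. *)

Section Germs.
Variable R : realType.

Fixpoint Ck (n m k : nat) (U : set 'rV[R]_n) (f : 'rV[R]_n -> 'rV[R]_m) : Prop :=
  match k with
  | 0 => forall x, U x -> {for x, continuous f}
  | k'.+1 => (forall x, U x -> differentiable f x) /\
             (forall v : 'rV[R]_n, Ck k' U ('D_v f))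
  end.

Definition smooth_germ (n m : nat) (f : 'rV[R]_n -> 'rV[R]_m) : Prop :=
  exists U : set 'rV[R]_n, [/\ open U, U 0 & forall k, Ck k U f].

Definition germ_eq (n : nat) (A B : set 'rV[R]_n) : Prop :=
  \forall x \near (0 : 'rV[R]_n), A x <-> B x.

Definition germ_nonempty (n : nat) (A : set 'rV[R]_n) : Prop :=
  forall U, nbhs (0 : 'rV[R]_n) U -> (A `&` U) !=set0.

(* f is onto the set-germ Z: the image of every sufficiently small
   neighbourhood of 0 represents Z.  Smallness is needed because the values of f
   far from 0, which are not part of the germ, could also come close to 0. *)
Definition germ_onto (p n : nat) (f : 'rV[R]_p -> 'rV[R]_n) (Z : set 'rV[R]_n) : Prop :=
  exists2 U0, nbhs (0 : 'rV[R]_p) U0 &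
    forall U, nbhs (0 : 'rV[R]_p) U -> U `<=` U0 -> germ_eq (f @` U) Z.

Definition immersion_germ (p n : nat) (f : 'rV[R]_p -> 'rV[R]_n) : Prop :=
  [/\ smooth_germ f, f 0 = 0 & injective ('d f 0 : 'rV[R]_p -> 'rV[R]_n)].

End Germs.

Section Constraints.
Variable R : realType.

(* The components of v with index in A, in increasing order of index. *)
Definition subrow (m : nat) (A : {set 'I_m}) (v : 'rV[R]_m) : 'rV[R]_#|A| :=
  \row_(a < #|A|) v 0 (enum_val a).

Section OneConstraint.
Variables (n q r : nat).
Variables (g : 'rV[R]_n -> 'rV[R]_q) (h : 'rV[R]_n -> 'rV[R]_r).

Definition constraint_germ : Prop :=
  [/\ smooth_germ g, smooth_germ h & h 0 = 0].

Definition feasible : set 'rV[R]_n :=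
  [set x | (forall j, g x 0 j <= 0) /\ h x = 0].

Definition active : {set 'I_q} := [set j | g 0 0 j == 0]%SET.

(* [jacobian f x] acts on row vectors from the right, hence is the transpose of
   the usual Jacobian matrix: its columns are the gradients. *)
Definition LICQ : Prop :=
  \rank (jacobian (fun x => row_mx (subrow active (g x)) (h x)) 0)
    = (#|active| + r)%N.

Definition MFCQ : Prop :=
  \rank (jacobian h 0) = r /\
  exists d : 'rV[R]_n,
    (forall j, j \in active -> ('d g 0 d) 0 j < 0) /\ 'd h 0 d = 0.

Definition tangent_cone : set 'rV[R]_n :=
  [set d | exists (x : nat -> 'rV[R]_n) (t : nat -> R),
     [/\ forall m, feasible (x m),
         x m @[m --> \oo] --> (0 : 'rV[R]_n),
         forall m, 0 < t m &
         t m *: x m @[m --> \oo] --> d]].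

Definition linearized_cone : set 'rV[R]_n :=
  [set d | (forall j, j \in active -> ('d g 0 d) 0 j <= 0) /\ 'd h 0 d = 0].

Definition polar (X : set 'rV[R]_n) : set 'rV[R]_n :=
  [set v | forall d, X d -> \sum_(a < n) v 0 a * d 0 a <= 0].

Definition ACQ : Prop := tangent_cone = linearized_cone.

Definition GCQ : Prop := polar tangent_cone = polar linearized_cone.

(* [kk] and [ii] are the sets of indices of the removed inequality and equality
   constraints; [row_free] of the matrix whose rows are the differentials of the
   h_j, j in ii, says that these differentials are linearly independent. *)
Definition reduction_data (p : nat) (kk : {set 'I_q}) (ii : {set 'I_r})
    (iota : 'rV[R]_p -> 'rV[R]_n) : Prop :=
  [/\ (p + #|ii|)%N = n,
      forall j, j \in kk -> g 0 0 j < 0,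
      row_free (jacobian (fun x => subrow ii (h x)) 0)^T,
      immersion_germ iota &
      germ_onto iota [set x | forall j, j \in ii -> h x 0 j = 0]].

End OneConstraint.

(* Precomposition with iota, keeping only the components outside A; used for
   both the inequality and the equality part of a reduction. *)
Definition reduce (p n m : nat) (A : {set 'I_m}) (iota : 'rV[R]_p -> 'rV[R]_n)
    (f : 'rV[R]_n -> 'rV[R]_m) : 'rV[R]_p -> 'rV[R]_#|~: A| :=
  fun u => subrow (~: A) (f (iota u)).

End Constraints.

(* Main.v *)
(* Let J be the differential of iota at 0.  It is injective with values in the
   kernel of d(h_ii) at 0, since h_ii vanishes along iota, and the dimensions
   agree, so the range of J is that kernel.  As the removed inequalities are
   strict near 0, the linearized cone upstairs is the J-image of the reduced one,
   and the rank conditions correspond by splitting off d(h_ii).  The same holds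
   for the tangent cones: injectivity of J gives |u| <= c |iota u| near 0, so
   feasible sequences lift to sequences converging to 0 with the same scaling.
   ACQ follows from injectivity of J, and GCQ from surjectivity of its adjoint,
   as the polar of J(X) is the preimage of the polar of X under that adjoint. *)

Require Import Defs.
From mathcomp Require Import all_boot all_order all_algebra.
From mathcomp Require Import all_classical all_reals all_analysis.
From mathcomp Require Import lra.

Set Implicit Arguments.
Unset Strict Implicit.
Unset Printing Implicit Defensive.

Import Order.TTheory GRing.Theory Num.Theory numFieldNormedType.Exports.

Local Open Scope classical_set_scope.
Local Open Scope ring_scope.

(** * Differentials of maps between row-vector spaces, and selection of components *)

Section RowVectorMaps.
Variable R : realType.

Lemma continuous_mulmxr (m n : nat) (A : 'M[R]_(m, n)) :
  continuous (mulmxr A : 'rV[R]_m -> 'rV[R]_n).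
Proof.
apply/linear_bounded_continuous/linear_boundedP.
(* A crude bound on the operator norm for the sup norm: each entry of [x *m A] is at most [k] times
   the norm of [x]. *)
pose k := \sum_i \sum_j `|A i j|.
have k0 : 0 <= k by apply: sumr_ge0 => i _; apply: sumr_ge0.
near=> r => x.
apply: (@le_trans _ _ (k * `|x|)); last first.
  by rewrite ler_wpM2r //; near: r; apply: nbhs_pinfty_ge; rewrite num_real.
rewrite [leLHS]/Num.Def.normr /= mx_normrE.
apply: bigmax_le => [|[i j] _ /=]; first by rewrite mulr_ge0.
rewrite !mxE (le_trans (ler_norm_sum _ _ _)) // mulr_suml ler_sum // => l _.
rewrite normrM mulrC ler_pM //.
  by rewrite (bigD1 j) //= lerDl sumr_ge0.
rewrite [leRHS]/Num.Def.normr /= mx_normrE (ord1 i).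
exact: (le_bigmax _ (fun ij : 'I_1 * 'I_m => `|x ij.1 ij.2|) (0, l)).
Unshelve. all: by end_near. Qed.

Lemma is_diff_mulmxr (p m n : nat) (f df : 'rV[R]_p -> 'rV[R]_m)
    (A : 'M[R]_(m, n)) x :
  is_diff x f df -> is_diff x (fun y => f y *m A) (fun v => df v *m A).
Proof.
move=> dfx; have dA : is_diff (f x) (mulmxr A) (mulmxr A).
  have cA := @continuous_mulmxr m n A.
  by apply: DiffDef; [exact: linear_differentiable | rewrite diff_lin].
exact: is_diff_comp dfx dA.
Qed.

(** Selecting components is a linear map, given by columns of the identity matrix; linearity and
    differentiability then come from matrix multiplication. *)
Lemma subrowE (m : nat) (A : {set 'I_m}) (v : 'rV[R]_m) :
  subrow A v = v *m colsub enum_val 1%:M.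
Proof. by rewrite mulmx_colsub mulmx1; apply/rowP => a; rewrite !mxE. Qed.

Lemma is_diff_subrow (p m : nat) (A : {set 'I_m}) (f df : 'rV[R]_p -> 'rV[R]_m) x :
  is_diff x f df -> is_diff x (fun y => subrow A (f y)) (fun v => subrow A (df v)).
Proof.
move=> /is_diff_mulmxr - /(_ _ (colsub enum_val 1%:M)) dfx.
by under eq_fun do rewrite subrowE; under [X in is_diff _ _ X]eq_fun do rewrite subrowE.
Qed.

Lemma is_diff_row_mx (p m n : nat) (f df : 'rV[R]_p -> 'rV[R]_m)
    (g dg : 'rV[R]_p -> 'rV[R]_n) x :
  is_diff x f df -> is_diff x g dg ->
  is_diff x (fun y => row_mx (f y) (g y)) (fun v => row_mx (df v) (dg v)).
Proof.
have row_mxE (u : 'rV[R]_m) (v : 'rV[R]_n) :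
    row_mx u v = u *m row_mx 1%:M 0 + v *m row_mx 0 1%:M.
  by rewrite !mul_mx_row !mulmx1 !mulmx0 add_row_mx addr0 add0r.
move=> /is_diff_mulmxr - /(_ _ (row_mx 1%:M 0)) dfx.
move=> /is_diff_mulmxr - /(_ _ (row_mx 0 1%:M)) dgx.
under eq_fun do rewrite row_mxE; under [X in is_diff _ _ X]eq_fun do rewrite row_mxE.
exact: is_diffD.
Qed.

Lemma mulmx_jacobian (m n : nat) (f : 'rV[R]_m -> 'rV[R]_n) x v :
  v *m jacobian f x = 'd f x v.
Proof. exact: mul_rV_lin1. Qed.

Lemma diff_near0 (m n : nat) (f : 'rV[R]_m -> 'rV[R]_n) x v :
  differentiable f x -> (\forall y \near x, f y = 0) -> 'd f x v = 0.
Proof.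
move=> df f0.
by rewrite -deriveE // (near_eq_derive v (g := cst 0) f0) derive_cst.
Qed.

(** Turns the rank conditions of LICQ and MFCQ into solvability of linear equations, so that they
    can be transferred without computing ranks. *)
Lemma mxrank_jacobian_full (m n : nat) (f : 'rV[R]_m -> 'rV[R]_n) x :
  \rank (jacobian f x) = n <-> forall w, exists v, 'd f x v = w.
Proof.
split=> [/eqP/row_fullP[B BJ] w|surj].
  by exists (w *m B); rewrite -mulmx_jacobian -mulmxA BJ mulmx1.
apply/eqP; rewrite -[_ == _]/(row_full _) -sub1mx; apply/row_subP => i.
have [v dv] := surj (row i 1%:M).
by rewrite -dv -mulmx_jacobian submxMl.
Qed.

Lemma subrow_enum_rank (m : nat) (A : {set 'I_m}) (v : 'rV[R]_m) j (jA : j \in A) :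
  subrow A v 0 (enum_rank_in jA j) = v 0 j.
Proof. by rewrite mxE enum_rankK_in. Qed.

Lemma subrow_eqP (m : nat) (A : {set 'I_m}) (u v : 'rV[R]_m) :
  subrow A u = subrow A v <-> forall j, j \in A -> u 0 j = v 0 j.
Proof.
split=> [uv j jA|uv]; first by rewrite -!(subrow_enum_rank _ jA) uv.
by apply/rowP => a; rewrite !mxE uv // enum_valP.
Qed.

Lemma subrow_inj (m : nat) (A : {set 'I_m}) (u v : 'rV[R]_m) :
  subrow A u = subrow A v -> subrow (~: A) u = subrow (~: A) v -> u = v.
Proof.
move=> /subrow_eqP uvA /subrow_eqP uvC; apply/rowP => j.
by have [/uvA //|jA] := boolP (j \in A); apply: uvC; rewrite inE.
Qed.

Lemma subrow0 (m : nat) (A : {set 'I_m}) : subrow A (0 : 'rV[R]_m) = 0.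
Proof. by rewrite subrowE mul0mx. Qed.

Lemma subrowB (m : nat) (A : {set 'I_m}) (u v : 'rV[R]_m) :
  subrow A (u - v) = subrow A u - subrow A v.
Proof. by rewrite !subrowE mulmxBl. Qed.

Lemma subrow_surj (m : nat) (A : {set 'I_m}) (u : 'rV[R]_#|A|) (w : 'rV[R]_#|~: A|) :
  exists v, subrow A v = u /\ subrow (~: A) v = w.
Proof.
(* The sum has at most one term, so it inverts [enum_val] without a membership proof for [j] and
   defaults to 0 outside [B]. *)
pose get (B : {set 'I_m}) (z : 'rV[R]_#|B|) (j : 'I_m) :=
  \sum_(a < #|B| | enum_val a == j) z 0 a.
have getE (B : {set 'I_m}) (z : 'rV[R]_#|B|) a : get B z (enum_val a) = z 0 a.
  by rewrite /get (big_pred1 a) // => b; rewrite (inj_eq enum_val_inj).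
exists (\row_j if j \in A then get A u j else get (~: A)%SET w j).
split; apply/rowP => a; rewrite !mxE; first by rewrite enum_valP getE.
by have := enum_valP a; rewrite inE => /negbTE ->; rewrite getE.
Qed.

End RowVectorMaps.

(** * First-order expansion along scaled sequences *)

Section ScaledSequences.
Variable R : realType.

Lemma diff_approx0 (m n : nat) (f : 'rV[R]_m -> 'rV[R]_n) (eps : R) :
  differentiable f 0 -> f 0 = 0 -> 0 < eps ->
  \forall u \near (0 : 'rV[R]_m), `|f u - 'd f 0 u| <= eps * `|u|.
Proof.
move=> /diff_locally/eqaddoP + f0 eps0 => /(_ _ eps0); apply: filterS => u /=.
by rewrite !fctE /= f0 add0r addr0.
Qed.

(** The remainder of [f] at [u k] is o(|u k|); multiplied by [t k] it tends to 0 because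
    [t k *: u k] stays bounded. *)
Lemma diff_scaled_cvg0 (m n : nat) (f : 'rV[R]_m -> 'rV[R]_n)
    (u : nat -> 'rV[R]_m) (t : nat -> R) (B : R) :
  differentiable f 0 -> f 0 = 0 ->
  u k @[k --> \oo] --> (0 : 'rV[R]_m) -> (forall k, 0 < t k) ->
  (\forall k \near \oo, `|t k *: u k| <= B) ->
  t k *: f (u k) - 'd f 0 (t k *: u k) @[k --> \oo] --> (0 : 'rV[R]_n).
Proof.
move=> df f0 u0 t0 tB; apply/cvgr0Pnorm_le => eps eps0.
(* [B] may be 0, so the divisor of [eps] is made strictly positive. *)
have B0 : 0 < `|B| + 1 by rewrite ltr_wpDl.
have small := u0 _ (diff_approx0 df f0 (divr_gt0 eps0 B0)).
near=> k; rewrite linearZ -scalerBr normrZ gtr0_norm //.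
have fu : `|f (u k) - 'd f 0 (u k)| <= eps / (`|B| + 1) * `|u k| by near: k.
rewrite (le_trans (ler_wpM2l (ltW (t0 k)) fu)) // mulrCA.
rewrite -[X in _ * (X * _)](gtr0_norm (t0 k)).
rewrite -normrZ mulrAC ler_pdivrMr // ler_wpM2l ?(ltW eps0) //.
have tuB : `|t k *: u k| <= B by near: k.
by rewrite (le_trans tuB) // (le_trans (ler_norm B)) // lerDl.
Unshelve. all: by end_near. Qed.

(** The cone asks for feasibility at every index, while germ arguments give it only eventually;
    dropping the first [N] terms bridges the gap. *)
Lemma tangent_cone_near (n q r : nat) (g : 'rV[R]_n -> 'rV[R]_q)
    (h : 'rV[R]_n -> 'rV[R]_r) (x : nat -> 'rV[R]_n) (t : nat -> R) d :
  (\forall k \near \oo, feasible g h (x k)) ->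
  x k @[k --> \oo] --> (0 : 'rV[R]_n) -> (forall k, 0 < t k) ->
  t k *: x k @[k --> \oo] --> d -> tangent_cone g h d.
Proof.
move=> [N _ feas] x0 t0 txd; exists (fun k => x (k + N)%N), (fun k => t (k + N)%N).
split=> [k||//|]; first by apply: feas; rewrite /= leq_addl.
  by rewrite (cvg_shiftn N x).
by rewrite (cvg_shiftn N (fun k => t k *: x k)).
Qed.

End ScaledSequences.

(** * LICQ as surjectivity, and linear algebra of a reduction at the origin *)

Section DifferentialReduction.
Variable R : realType.

(** Prescribing values [a] on all of ['I_q] and reading only the active ones avoids row vectors
    whose length depends on the active set. *)
Lemma LICQ_surj (n q r : nat) (g : 'rV[R]_n -> 'rV[R]_q) (h : 'rV[R]_n -> 'rV[R]_r) :
  differentiable g 0 -> differentiable h 0 ->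
  LICQ g h <-> forall (a : 'rV_q) (b : 'rV_r), exists d : 'rV_n,
    (forall j, j \in active g -> 'd g 0 d 0 j = a 0 j) /\ 'd h 0 d = b.
Proof.
move=> /differentiableP dg /differentiableP dh; rewrite /LICQ mxrank_jacobian_full.
have dgh := is_diff_row_mx (is_diff_subrow (active g) dg) dh.
rewrite (diff_val (is_diff_def := dgh)).
split=> [surj a b|surj w].
  have [d /eq_row_mx[/subrow_eqP da db]] := surj (row_mx (subrow (active g) a) b).
  by exists d.
have [a [aw _]] := subrow_surj (lsubmx w) 0.
have [d [/subrow_eqP da db]] := surj a (rsubmx w).
by exists d; rewrite da aw db hsubmxK.
Qed.

Section Reduction.
Variables (n q r p : nat) (g : 'rV[R]_n -> 'rV[R]_q) (h : 'rV[R]_n -> 'rV[R]_r).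
Variables (kk : {set 'I_q}) (ii : {set 'I_r}) (iota : 'rV[R]_p -> 'rV[R]_n).
Hypotheses (dg : differentiable g 0) (dh : differentiable h 0).
Hypothesis diota : differentiable iota 0.
Hypothesis red : reduction_data g h kk ii iota.

Let iota0 : iota 0 = 0. Proof. by case: red => _ _ _ []. Qed.

Let cvg_iota : iota u @[u --> (0 : 'rV[R]_p)] --> (0 : 'rV[R]_n).
Proof. by rewrite -[X in _ --> X]iota0; exact: differentiable_continuous. Qed.

Lemma diff_reduce (m : nat) (A : {set 'I_m}) (f : 'rV[R]_n -> 'rV[R]_m) v :
  differentiable f 0 ->
  'd (reduce A iota f) 0 v = subrow (~: A) ('d f 0 ('d iota 0 v)).
Proof.
rewrite -iota0 => /differentiableP df.
have dfi := is_diff_subrow (~: A) (is_diff_comp (differentiableP diota) df).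
by rewrite (diff_val (is_diff_def := dfi)).
Qed.

Lemma differentiable_reduce (m : nat) (A : {set 'I_m}) (f : 'rV[R]_n -> 'rV[R]_m) :
  differentiable f 0 -> differentiable (reduce A iota f) 0.
Proof.
rewrite -iota0 => /differentiableP df.
have dfi := is_diff_subrow (~: A) (is_diff_comp (differentiableP diota) df).
exact: (ex_diff (is_diff_def := dfi)).
Qed.

Lemma near_reduction_zeros :
  \forall u \near (0 : 'rV[R]_p), subrow ii (h (iota u)) = 0.
Proof.
case: red => _ _ _ _ [U0 nU0 onto].
(* The equality of germs holds near 0 in the target; continuity of [iota] pulls it back to the
   source. *)
have near_im := cvg_iota (onto U0 nU0 (@subset_refl _ U0)).
near=> u; rewrite -(subrow0 _ ii); apply/subrow_eqP => j jii; rewrite mxE.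
have im_u : (iota @` U0) (iota u) by exists u => //; near: u.
have [+ _] : (iota @` U0) (iota u) <-> forall j, j \in ii -> h (iota u) 0 j = 0.
  by near: u.
by move=> /(_ im_u) /(_ _ jii).
Unshelve. all: by end_near. Qed.

Let is_diff_subrow_h := is_diff_subrow ii (differentiableP dh).

Lemma diff_subrow_surj w : exists d, subrow ii ('d h 0 d) = w.
Proof.
case: red => _ _ free _ _.
have [B /(congr1 trmx)] := row_freeP free.
rewrite trmx_mul trmxK trmx1 => BM.
exists (w *m B^T).
have := mulmx_jacobian (fun x => subrow ii (h x)) 0 (w *m B^T).
by rewrite -mulmxA BM mulmx1 (diff_val (is_diff_def := is_diff_subrow_h)).
Qed.

Lemma range_diff_immersion d :
  subrow ii ('d h 0 d) = 0 <-> exists e, d = 'd iota 0 e.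
Proof.
case: red => dimE _ free [_ _ inj] _.
pose M := jacobian (fun x => subrow ii (h x)) 0.
have ME v : v *m M = subrow ii ('d h 0 v).
  by rewrite mulmx_jacobian (diff_val (is_diff_def := is_diff_subrow_h)).
(* The selected components of [h] vanish identically along [iota] near 0, so the chain rule kills
   their differentials on the range of ['d iota 0]. *)
have JM e : subrow ii ('d h 0 ('d iota 0 e)) = 0.
  have dh' : differentiable h (iota 0) by rewrite iota0.
  have dhi := is_diff_subrow ii
    (is_diff_comp (differentiableP diota) (differentiableP dh')).
  have := diff_near0 e (ex_diff (is_diff_def := dhi)) near_reduction_zeros.
  by rewrite (diff_val (is_diff_def := dhi)) /= iota0.
split=> [dM|[e -> //]].
have freeJ : row_free (jacobian iota 0).
  apply: inj_row_free => v; rewrite mulmx_jacobian => Jv.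
  by apply: inj; rewrite Jv linear0.
have JkerM : (jacobian iota 0 <= kermx M)%MS.
  apply/row_subP => i; apply/sub_kermxP.
  by rewrite ME rowE mulmx_jacobian JM.
(* Dimension count: the kernel has dimension n - |ii| = p, which is also the rank of the injective
   ['d iota 0]. *)
have : (kermx M <= jacobian iota 0)%MS.
  rewrite -(mxrank_leqif_sup JkerM) (eqP freeJ) mxrank_ker -mxrank_tr (eqP free).
  by rewrite -[X in (X - _)%N]dimE addnK.
have /sub_kermxP dker : d *m M = 0 by rewrite ME.
move=> /(submx_trans dker)/submxP[e ->].
by exists e; rewrite mulmx_jacobian.
Qed.

(** A removed inequality is strict at 0, hence inactive, so [enum_val] matches the active indices of
    the two systems. *)
Lemma forall_active_reduce (P : 'I_q -> Prop) :
  (forall a, a \in active (reduce kk iota g) -> P (enum_val a)) <->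
  (forall j, j \in active g -> P j).
Proof.
have activeE a : (a \in active (reduce kk iota g)) = (enum_val a \in active g).
  by rewrite !inE /reduce mxE iota0.
split=> [Pr j jact|Pg a]; last by rewrite activeE => /Pg.
have jkk : j \in ~: kk.
  case: red => _ ltkk _ _ _; rewrite inE; apply/negP => /ltkk.
  by move: jact; rewrite inE => /eqP ->; rewrite ltxx.
by have := Pr (enum_rank_in jkk j); rewrite activeE enum_rankK_in //; apply.
Qed.

(** [Q] is left abstract to serve both the strict inequalities of MFCQ and the weak ones of the
    linearized cone. *)
Lemma linearized_condition_reduce (Q : R -> Prop) e :
  (forall a, a \in active (reduce kk iota g) -> Q ('d (reduce kk iota g) 0 e 0 a)) <->
  (forall j, j \in active g -> Q ('d g 0 ('d iota 0 e) 0 j)).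
Proof.
rewrite -(forall_active_reduce (fun j => Q ('d g 0 ('d iota 0 e) 0 j))).
by split=> Qe a /Qe; rewrite diff_reduce // mxE.
Qed.

Lemma diff_reduce_eq0 e :
  'd (reduce ii iota h) 0 e = 0 <-> 'd h 0 ('d iota 0 e) = 0.
Proof.
rewrite diff_reduce //; split=> [he0|->]; last exact: subrow0.
apply: (@subrow_inj _ _ ii); last by rewrite subrow0.
by rewrite subrow0; apply/range_diff_immersion; exists e.
Qed.

Lemma kernel_diff d : 'd h 0 d = 0 -> exists e, d = 'd iota 0 e.
Proof. by move=> hd; apply/range_diff_immersion; rewrite hd subrow0. Qed.

(** * Transfer of LICQ, MFCQ and the linearized cone *)

Lemma diff_surj_reduce :
  (forall b, exists d, 'd h 0 d = b) <->
  (forall b, exists e, 'd (reduce ii iota h) 0 e = b).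
Proof.
split=> surj b.
  (* Padding [b] by 0 on [ii] forces any preimage into the range of ['d iota 0]. *)
  have [b1 [b1ii b1C]] := subrow_surj (0 : 'rV_#|ii|) b.
  have [d db] := surj b1.
  have /range_diff_immersion[e de] : subrow ii ('d h 0 d) = 0 by rewrite db.
  by exists e; rewrite diff_reduce // -de db.
(* First [d] settles the components in [ii]; the correction ['d iota 0 e] leaves these unchanged and
   settles the others. *)
have [d db] := diff_subrow_surj (subrow ii b).
have [e eb] := surj (subrow (~: ii) (b - 'd h 0 d)).
have e0 : subrow ii ('d h 0 ('d iota 0 e)) = 0 by apply/range_diff_immersion; exists e.
exists (d + 'd iota 0 e); rewrite linearD addrC; apply/(canLR (subrK _))/esym.
apply: (@subrow_inj _ _ ii); last by rewrite -diff_reduce.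
by rewrite subrowB db subrr.
Qed.

Lemma LICQ_reduce : LICQ g h <-> LICQ (reduce kk iota g) (reduce ii iota h).
Proof.
rewrite !LICQ_surj //; try exact: differentiable_reduce.
split=> surj a b.
  (* The values on [kk] are arbitrary, whereas the zeros on [ii] put [d] in the range of
     ['d iota 0]. *)
  have [a1 [_ a1C]] := subrow_surj (0 : 'rV_#|kk|) a.
  have [b1 [b1ii b1C]] := subrow_surj (0 : 'rV_#|ii|) b.
  have [d [da db]] := surj a1 b1.
  have /range_diff_immersion[e de] : subrow ii ('d h 0 d) = 0 by rewrite db.
  exists e; rewrite !diff_reduce // -de db; split=> // j jact.
  rewrite -a1C !mxE; move: j jact.
  exact/(forall_active_reduce (fun j => 'd g 0 d 0 j = a1 0 j)).
have [d db] := diff_subrow_surj (subrow ii b).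
have [e [ea eb]] :=
  surj (subrow (~: kk) (a - 'd g 0 d)) (subrow (~: ii) (b - 'd h 0 d)).
have e0 : subrow ii ('d h 0 ('d iota 0 e)) = 0 by apply/range_diff_immersion; exists e.
exists (d + 'd iota 0 e); split.
  apply/(forall_active_reduce (fun j => 'd g 0 (d + 'd iota 0 e) 0 j = a 0 j)) => j /ea.
  rewrite diff_reduce // linearD !mxE.
  by move=> ->; rewrite addrC subrK.
rewrite linearD addrC; apply/(canLR (subrK _))/esym.
apply: (@subrow_inj _ _ ii); last by rewrite -diff_reduce.
by rewrite subrowB db subrr.
Qed.

Lemma MFCQ_reduce : MFCQ g h <-> MFCQ (reduce kk iota g) (reduce ii iota h).
Proof.
rewrite /MFCQ !mxrank_jacobian_full diff_surj_reduce.
split=> -[surj [d [dneg d0]]]; split=> //.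
  have [e de] := kernel_diff d0.
  exists e.
  by rewrite (linearized_condition_reduce (fun t => t < 0)) diff_reduce_eq0 -de.
exists ('d iota 0 d).
by rewrite -(linearized_condition_reduce (fun t => t < 0)) -diff_reduce_eq0.
Qed.

Lemma linearized_cone_reduce :
  linearized_cone g h =
    'd iota 0 @` linearized_cone (reduce kk iota g) (reduce ii iota h).
Proof.
have linE e : linearized_cone (reduce kk iota g) (reduce ii iota h) e <->
    linearized_cone g h ('d iota 0 e).
  rewrite /linearized_cone /= (linearized_condition_reduce (fun t => t <= 0)).
  by rewrite diff_reduce_eq0.
apply/seteqP; split=> [d Ld|_ [e /linE + <-] //].
by have [e de] := kernel_diff Ld.2; exists e; rewrite ?linE -?de.
Qed.

(** * Feasible sets and tangent cones under reduction *)

Lemma near_feasible_reduce :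
  \forall u \near (0 : 'rV[R]_p),
    feasible (reduce kk iota g) (reduce ii iota h) u -> feasible g h (iota u).
Proof.
(* Keeping [j \in kk] inside the filter lets the finite intersection below run over all of
   ['I_q]. *)
have gneg_j j : \forall x \near (0 : 'rV[R]_n), j \in kk -> g x 0 j < 0.
  have [jkk|_] := boolP (j \in kk); last by apply: filterE.
  have gj0 : g 0 0 j < 0 by case: red => _ /(_ j jkk).
  have cg : g x 0 j @[x --> (0 : 'rV[R]_n)] --> g 0 0 j.
    exact: (continuous_comp (differentiable_continuous dg)
                            (@coord_continuous _ _ _ 0 j _)).
  near=> x => _; near: x; exact: (cvgr_lt _ cg).
have gneg : \forall u \near (0 : 'rV[R]_p), forall j, j \in kk -> g (iota u) 0 j < 0.
  exact: cvg_iota (filter_forall _ gneg_j).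
have hzero := near_reduction_zeros.
near=> u => -[gu hu]; split=> [j|].
  have [jkk|jkk] := boolP (j \in kk); first by apply: ltW; move: j jkk; near: u.
  have jC : j \in ~: kk by rewrite inE.
  by have := gu (enum_rank_in jC j); rewrite subrow_enum_rank.
apply: (@subrow_inj _ _ ii); last by rewrite subrow0.
by rewrite subrow0; near: u.
Unshelve. all: by end_near. Qed.

Lemma feasible_reduce u :
  feasible g h (iota u) -> feasible (reduce kk iota g) (reduce ii iota h) u.
Proof. by move=> [gu hu]; split=> [a|]; rewrite /reduce ?mxE // hu subrow0. Qed.

Lemma diff_immersion_lower_bound :
  exists P : 'M[R]_(n, p), jacobian iota 0 *m P = 1%:M /\
  exists2 c : R, 0 < c & \forall u \near (0 : 'rV[R]_p), `|u| <= c * `|iota u|.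
Proof.
have [P JP] : exists P, jacobian iota 0 *m P = 1%:M.
  apply/row_freeP/inj_row_free => v; rewrite mulmx_jacobian => Jv.
  by case: red => _ _ _ [_ _ inj] _; apply: inj; rewrite Jv linear0.
have PK e : 'd iota 0 e *m P = e by rewrite -mulmx_jacobian -mulmxA JP mulmx1.
exists P; split=> //.
have [c c0 cP] := linear_lipschitz (@continuous_mulmxr _ _ _ P).
(* With J the differential of [iota], |u| <= c |J u| <= c |iota u| + c |iota u - J u|; taking the
   error below |u| / (2c) lets half of |u| be absorbed on the left. *)
exists (2 * c); first by rewrite mulr_gt0.
have c2 : 0 < (2 * c)^-1 by rewrite invr_gt0 mulr_gt0.
have := diff_approx0 diota iota0 c2; apply: filterS => u.
rewrite mulrC ler_pdivlMr ?mulr_gt0 // => approx.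
have := cP ('d iota 0 u); rewrite /= PK => lower.
have tri : `|'d iota 0 u| <= `|iota u| + `|iota u - 'd iota 0 u|.
  by rewrite (distrC (iota u)) -lerBlDl (le_trans (lerB_dist _ _)).
have := ler_wpM2l (ltW c0) tri.
lra.
Qed.

Lemma tangent_cone_reduce :
  tangent_cone g h = 'd iota 0 @` tangent_cone (reduce kk iota g) (reduce ii iota h).
Proof.
have cJ := diff_continuous diota.
have [P [JP [c c0 lower]]] := diff_immersion_lower_bound.
have PK e : 'd iota 0 e *m P = e by rewrite -mulmx_jacobian -mulmxA JP mulmx1.
apply/seteqP; split=> [d [y [t [feas y0 t0 tyd]]]|_ [e [u [t [feas u0 t0 tue]]] <-]].
  case: red => _ _ _ _ [U0 nU0 onto].
  (* Shrinking [U0] is allowed by [germ_onto] and makes every lift taken from [U] obey the norm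
     bound. *)
  pose U := U0 `&` [set u | `|u| <= c * `|iota u|].
  have nU : nbhs (0 : 'rV[R]_p) U by exact: filterI.
  have y_im : \forall k \near \oo,
      (iota @` U) (y k) <-> forall j, j \in ii -> h (y k) 0 j = 0.
    exact: y0 (onto _ nU (@subIsetl _ _ _)).
  (* The default 0 is taken only when [y k] has no lift in [U], which stops happening for large [k]
     because [y k] is feasible. *)
  have /choice[u uP] : forall k, exists v, (iota @` U) (y k) -> U v /\ iota v = y k.
    move=> k; have [[v Uv vy]|nim] := pselect ((iota @` U) (y k)); first by exists v.
    by exists 0.
  have near_u : \forall k \near \oo, iota (u k) = y k /\ `|u k| <= c * `|y k|.
    apply: filterS y_im => k [_ im_y].
    have [[_ ule] uy] : U (u k) /\ iota (u k) = y k.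
      by apply: uP; apply: im_y => j _; rewrite (feas k).2 mxE.
    by split=> //; rewrite -uy.
  have u0 : u k @[k --> \oo] --> (0 : 'rV[R]_p).
    apply/cvgr0Pnorm_le => eps eps0.
    have epsc : 0 < eps / c by rewrite divr_gt0.
    have ysmall : \forall k \near \oo, `|y k| <= eps / c.
      by move/cvgr0Pnorm_le: y0; apply.
    near=> k.
    have [_ ule] : iota (u k) = y k /\ `|u k| <= c * `|y k| by near: k.
    by rewrite (le_trans ule) // mulrC -ler_pdivlMr //; near: k.
  have tub : \forall k \near \oo, `|t k *: u k| <= c * (`|d| + 1).
    have tyb : \forall k \near \oo, `|t k *: y k| <= `|d| + 1.
      by have /cvgr_norm_le := tyd; apply; rewrite ltrDl.
    near=> k.
    have [_ ule] : iota (u k) = y k /\ `|u k| <= c * `|y k| by near: k.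
    have tyk : `|t k *: y k| <= `|d| + 1 by near: k.
    apply: le_trans (ler_wpM2l (ltW c0) tyk).
    by rewrite !normrZ mulrCA ler_wpM2l.
  have rest := diff_scaled_cvg0 diota iota0 u0 t0 tub.
  (* Eventually [iota (u k) = y k], so this sequence is [t k *: y k] minus a remainder tending to
     0. *)
  have tJu : 'd iota 0 (t k *: u k) @[k --> \oo] --> d.
    rewrite -[d]subr0; apply: cvg_trans (cvgB tyd rest).
    apply: near_eq_cvg; apply: filterS near_u => k [uy _] /=.
    by rewrite !fctE /= uy subKr.
  (* Multiplication by the one-sided inverse [P] recovers the limit of the scaled lifts from that of
     their images. *)
  have tu : t k *: u k @[k --> \oo] --> d *m P.
    have := cvg_comp _ _ tJu (@continuous_mulmxr _ _ _ P d).
    by rewrite (_ : _ \o _ = fun k => t k *: u k);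
      last by apply/funext => k /=; rewrite PK.
  exists (d *m P).
    apply: (tangent_cone_near _ u0 t0 tu); apply: filterS near_u => k [uy _].
    by apply: feasible_reduce; rewrite uy.
  exact: cvg_unique (cvg_comp _ _ tu (cJ _)) tJu.
have tub : \forall k \near \oo, `|t k *: u k| <= `|e| + 1.
  by have /cvgr_norm_le := tue; apply; rewrite ltrDl.
(* For the converse inclusion the same remainder is added to the images of the scaled sequence. *)
have rest := diff_scaled_cvg0 diota iota0 u0 t0 tub.
apply: (@tangent_cone_near _ _ _ _ _ _ (fun k => iota (u k)) t) => //.
- have near_feas : \forall k \near \oo,
      feasible (reduce kk iota g) (reduce ii iota h) (u k) -> feasible g h (iota (u k)).
    exact: u0 near_feasible_reduce.
  by apply: filterS near_feas => k; apply.
- exact: (cvg_comp _ _ u0 cvg_iota).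
- have tJu : 'd iota 0 (t k *: u k) @[k --> \oo] --> 'd iota 0 e.
    exact: (cvg_comp _ _ tue (cJ e)).
  have := cvgD rest tJu; rewrite add0r.
  rewrite (_ : _ + _ = fun k => t k *: iota (u k));
    last by apply/funext => k; exact: subrK.
  exact.
Unshelve. all: by end_near. Qed.

(** * Transfer of ACQ and GCQ *)

Lemma ACQ_reduce : ACQ g h <-> ACQ (reduce kk iota g) (reduce ii iota h).
Proof.
rewrite /ACQ tangent_cone_reduce linearized_cone_reduce.
split=> [|-> //]; move/seteqP=> [CL LC].
have inj : injective ('d iota 0) by case: red => _ _ _ [].
apply/seteqP; split=> e Xe; rewrite -(image_inj inj).
  by apply: CL; exact: imageP.
by apply: LC; exact: imageP.
Qed.

(** The transposed Jacobian represents the adjoint of ['d iota 0] for the dot product. *)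
Lemma polar_image_diff (X : set 'rV[R]_p) v :
  polar ('d iota 0 @` X) v <-> polar X (v *m (jacobian iota 0)^T).
Proof.
have pairE e : \sum_(a < n) v 0 a * ('d iota 0 e) 0 a =
    \sum_(a < p) (v *m (jacobian iota 0)^T) 0 a * e 0 a.
  have dotE m (x y : 'rV[R]_m) : \sum_(a < m) x 0 a * y 0 a = (x *m y^T) 0 0.
    by rewrite mxE; apply: eq_bigr => a _; rewrite mxE.
  by rewrite !dotE -mulmx_jacobian trmx_mul mulmxA.
split=> [Xv e Xe|Xv _ [e Xe <-]]; last by rewrite pairE; apply: Xv.
by rewrite -pairE; apply: Xv; exists e.
Qed.

Lemma GCQ_reduce : GCQ g h <-> GCQ (reduce kk iota g) (reduce ii iota h).
Proof.
rewrite /GCQ tangent_cone_reduce linearized_cone_reduce.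
have [P [JP _]] := diff_immersion_lower_bound.
(* Transposing [JP] shows that [v *m P^T] is a preimage of [v] under the adjoint, so every vector of
   the reduced space is tested by the polars upstairs. *)
have pullback (X : set 'rV[R]_p) v : polar ('d iota 0 @` X) (v *m P^T) <-> polar X v.
  by rewrite polar_image_diff -mulmxA -trmx_mul JP trmx1 mulmx1.
split=> polarE; apply/funext => v; apply/propext.
  by rewrite -pullback polarE pullback.
by rewrite !polar_image_diff polarE.
Qed.

End Reduction.
End DifferentialReduction.

Lemma smooth_germ_differentiable (R : realType) (n m : nat)
    (f : 'rV[R]_n -> 'rV[R]_m) :
  smooth_germ f -> differentiable f 0.
Proof. by case=> U [_ U0 /(_ 1%N)[df _]]; exact: df. Qed.

Theorem theorem3p2 (R : realType) (n q r p : nat)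
    (g : 'rV[R]_n -> 'rV[R]_q) (h : 'rV[R]_n -> 'rV[R]_r)
    (kk : {set 'I_q}) (ii : {set 'I_r}) (iota : 'rV[R]_p -> 'rV[R]_n) :
  constraint_germ g h ->
  germ_nonempty (feasible g h) ->
  reduction_data g h kk ii iota ->
  [/\ LICQ g h <-> LICQ (reduce kk iota g) (reduce ii iota h),
      MFCQ g h <-> MFCQ (reduce kk iota g) (reduce ii iota h),
      ACQ g h <-> ACQ (reduce kk iota g) (reduce ii iota h) &
      GCQ g h <-> GCQ (reduce kk iota g) (reduce ii iota h)].
Proof.
move=> [/smooth_germ_differentiable dg /smooth_germ_differentiable dh _] _ red.
have diota : differentiable iota 0.
  by case: red => _ _ _ [/smooth_germ_differentiable].
split; [exact: LICQ_reduce|exact: MFCQ_reduce|exact: ACQ_reduce|exact: GCQ_reduce].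
Qed.
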